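(* Let $P_1$ be the uniform distribution on $[0,\frac12]$, let $P_2$ be the discrete distribution with mass $\frac13$ at each point of $D=\{\frac23,\frac56,1\}$, and let $P=\frac12P_1+\frac12P_2$. Let $\alpha$ be an optimal set of two-means for $P$. Then $\alpha=\{\frac14,\frac56\}$, and the quantization error is $V_2(P)=\frac{17}{864}$.
   Context: For a Borel probability measure $Q$ on $\mathbb R$ with finite second moment and a finite nonempty set $\alpha\subset\mathbb R$, put $V(Q;\alpha)=\int\min_{a\in\alpha}(x-a)^2\,dQ(x)$ and $V_n(Q)=\inf\{V(Q;\alpha):\alpha\subset\mathbb R,\ 1\le\mathrm{card}(\alpha)\le n\}$ (the $n$th quantization error). A set $\alpha$ with $1\le\mathrm{card}(\alpha)\le n$ is an optimal set of $n$-means for $Q$ if $V(Q;\alpha)=V_n(Q)$; ''two-means'' is the case $n=2$. *)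

(* Defs.v *)
From HB Require Import structures.
From mathcomp Require Import all_boot all_order all_algebra finmap ring lra.
From mathcomp Require Import all_classical all_reals all_analysis.

Set Implicit Arguments.
Unset Strict Implicit.
Unset Printing Implicit Defensive.

Import Order.TTheory GRing.Theory Num.Theory.

Local Open Scope classical_set_scope.
Local Open Scope ring_scope.

Section Quantization.
Context {R : realType}.
Implicit Types (Q : probability (measurableTypeR R) R) (alpha : {fset R}).
Local Open Scope ereal_scope.

(* The neutral element +oo is returned only for an empty set, which the
   cardinality constraint in [quant_error] and [optimal_set] excludes. *)
Definition min_sqdist alpha (x : R) : \bar R :=
  \big[mine/+oo]_(a <- enum_fset alpha) ((x - a) ^+ 2)%:E.

Definition distortion Q alpha : \bar R := \int[Q]_x min_sqdist alpha x.

Definition quant_error n Q : \bar R :=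
  ereal_inf [set distortion Q alpha | alpha in
               [set alpha : {fset R} | (1 <= #|` alpha| <= n)%N]].

Definition optimal_set n Q alpha : Prop :=
  (1 <= #|` alpha| <= n)%N /\ distortion Q alpha = quant_error n Q.

End Quantization.

Section MixedDistribution.
Context {R : realType}.
Local Notation T := (measurableTypeR R).

Lemma half_gt0 : (0 : R) < 2^-1. Proof. by rewrite invr_gt0. Qed.

Definition P1 : probability T R := uniform_prob half_gt0.

Definition D : 3.-tuple R := [tuple 2 / 3; 5 / 6; 1].

Definition discrete_D : set T -> \bar R :=
  msum (fun k => mscale (3^-1)%:nng (dirac (D`_k : T))) 3.

HB.instance Definition _ := Measure.on discrete_D.

Let discrete_D_setT : discrete_D setT = 1%E.
Proof.
rewrite /discrete_D /msum !big_ord_recr big_ord0/=.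
rewrite /mscale/= !diracE !in_setT !mule1.
by rewrite add0e -!EFinD; congr EFin; field.
Qed.

HB.instance Definition _ :=
  @Measure_isProbability.Build _ _ R discrete_D discrete_D_setT.

Definition P2 : probability T R := discrete_D.

Definition half_mixture (mu nu : probability T R) : set T -> \bar R :=
  measure_add (mscale (2^-1)%:nng mu) (mscale (2^-1)%:nng nu).

Section mixture_instance.
Variables mu nu : probability T R.

HB.instance Definition _ := Measure.on (half_mixture mu nu).

Let half_mixture_setT : half_mixture mu nu setT = 1%E.
Proof.
rewrite /half_mixture measure_addE/=.
rewrite /mscale/= !probability_setT !mule1.
by rewrite -EFinD; congr EFin; field.
Qed.

HB.instance Definition _ := @Measure_isProbability.Build _ _ R
  (half_mixture mu nu) half_mixture_setT.
End mixture_instance.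

Definition P : probability T R := half_mixture P1 P2.

End MixedDistribution.

(* Main.v *)
(** Write the two points as [a <= b] and let [m] be their midpoint.  If
    [1/2 <= m <= 2/3], each component of [P] lies in a single Voronoi cell, and
    the parallel axis theorem gives the distortion
    [17/864 + (a - 1/4)^2/2 + (b - 5/6)^2/2].  If [2/3 < m], then [a] serves
    both the interval and the point [2/3], which alone costs at least
    [1/96 + 25/1152 > 17/864].  If [m < 1/2], then [b] serves all of [D] and a
    final segment of the interval of length [s > 0]; minimizing over [a] and
    [b] leaves an excess over [17/864] of at least
    [s (7/144 + s/3 + s^2/2) / (2 s + 1)]. *)

Require Import Defs.
From mathcomp Require Import all_boot all_order all_algebra finmap.
From mathcomp Require Import all_classical all_reals all_analysis.
From mathcomp Require Import measurable_realfun ring lra.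

Import Order.TTheory GRing.Theory Num.Theory.
Import numFieldNormedType.Exports.

Local Open Scope ring_scope.

(** A singleton is the case [a = b], so the later case analysis on the midpoint needs no separate
    one-point case. *)
Lemma min_sqdist_card2 {R : realType} (alpha : {fset R}) :
  (1 <= #|` alpha| <= 2)%N ->
  exists a b : R, [/\ a <= b, alpha = [fset a; b]%fset &
    forall x, min_sqdist alpha x =
              (Num.min ((x - a) ^+ 2) ((x - b) ^+ 2))%:E].
Proof.
rewrite /min_sqdist => card_alpha.
have : alpha =i enum_fset alpha by [].
move: card_alpha; case: (enum_fset alpha) => [|a [|b [|c s]]] //= _ mem_alpha.
  exists a, a; split=> // [|x]; last first.
    by rewrite big_seq1 minxx.
  by apply/fsetP => y; rewrite mem_alpha !inE orbb.
have alphaE : alpha = [fset a; b]%fset.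
  by apply/fsetP => y; rewrite mem_alpha !inE.
have minE x : \big[mine/+oo%E]_(d <- [:: a; b]) ((x - d) ^+ 2)%:E =
              (Num.min ((x - a) ^+ 2) ((x - b) ^+ 2))%:E.
  by rewrite big_cons big_seq1 EFin_min.
have [ab|/ltW ba] := leP a b; first by exists a, b.
exists b, a; split=> // [|x]; first by rewrite alphaE fsetUC.
by rewrite minE minC.
Qed.

Lemma continuous_sqdist {R : realType} (c : R) :
  continuous (fun x : R => (x - c) ^+ 2).
Proof.
move=> x; apply: cvgM; apply: cvgB; first exact: cvg_id.
- exact: cvg_cst.
- exact: cvg_id.
- exact: cvg_cst.
Qed.

Lemma measurable_sqdist {R : realType} (D : set R) (c : R) :
  measurable_fun D (fun x : R => (x - c) ^+ 2).
Proof.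
apply: measurable_funTS; apply: continuous_measurable_fun.
exact: continuous_sqdist.
Qed.

Lemma measurable_min_sqdist {R : realType} (D : set R) (a b : R) :
  measurable_fun D
    (fun x : R => Num.min ((x - a) ^+ 2) ((x - b) ^+ 2)).
Proof. by apply: measurable_minr; exact: measurable_sqdist. Qed.

Lemma integral_sqdist {R : realType} (u v c : R) : u <= v ->
  (\int[lebesgue_measure]_(x in `[u, v]%classic) ((x - c) ^+ 2)%:E =
   (((v - c) ^+ 3 - (u - c) ^+ 3) / 3)%:E)%E.
Proof.
(* The one-point interval is split off from the fundamental theorem of calculus; it does occur, when
   [t] is clamped to an endpoint. *)
rewrite le_eqVlt => /predU1P[<-|uv].
  by rewrite set_itv1 integral_set1 subrr mul0r.
pose F : R -> R := 3^-1 *: (id - cst c) ^+ 3.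
have dF (x : R) : is_derive x (1 : R) F ((x - c) ^+ 2).
  apply: is_derive_eq.
  by rewrite /= /GRing.scale /= !fctE; field.
have cF (x : R) : {for x, continuous F}.
  by apply: differentiable_continuous; apply/derivable1_diffP.
rewrite (@continuous_FTC2 _ _ F) //.
- by rewrite -EFinB /F /= !fctE -scalerBr [in RHS]mulrC.
- by apply: continuous_subspaceT; exact: continuous_sqdist.
- split=> [x _||].
  + exact: ex_derive.
  + by apply: cvg_at_right_filter; exact: cF.
  + by apply: cvg_at_left_filter; exact: cF.
- by move=> x _; rewrite derive1E derive_val.
Qed.

Lemma integral_itv_cat {R : realType} (f : R -> R) (u v w : R) :
  measurable_fun setT f -> (forall x, 0 <= f x) -> u <= v <= w ->
  (\int[lebesgue_measure]_(x in `[u, w]%classic) (f x)%:E =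
   \int[lebesgue_measure]_(x in `[u, v]%classic) (f x)%:E +
   \int[lebesgue_measure]_(x in `[v, w]%classic) (f x)%:E)%E.
Proof.
move=> /measurable_EFinP mf f0 /andP[uv vw].
rewrite -(@integral_itv_obnd_cbnd _ v); last exact: measurable_funTS.
rewrite (@itv_bndbnd_setU _ _ _ (BRight v)) ?bnd_simp//.
rewrite ge0_integral_setU//=.
- exact: measurable_funTS.
- by move=> x _; rewrite lee_fin.
apply/disj_setPLR => x /=; rewrite !in_itv/= => /andP[_ xv].
by rewrite ltNge xv.
Qed.

(** Endpoints are null, so the comparisons are asked on open intervals only and become vacuous on a
    degenerate piece. *)
Lemma integral_min_sqdist {R : realType} (u t w a b : R) : u <= t <= w ->
  (forall x, u < x < t -> (x - a) ^+ 2 <= (x - b) ^+ 2) ->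
  (forall x, t < x < w -> (x - b) ^+ 2 <= (x - a) ^+ 2) ->
  (\int[lebesgue_measure]_(x in `[u, w]%classic)
     (Num.min ((x - a) ^+ 2) ((x - b) ^+ 2))%:E =
   (((t - a) ^+ 3 - (u - a) ^+ 3) / 3 +
    ((w - b) ^+ 3 - (t - b) ^+ 3) / 3)%:E)%E.
Proof.
move=> utw min_a min_b; have /andP[ut tw] := utw.
rewrite (@integral_itv_cat _ _ u t w) //; last 2 first.
- exact: measurable_min_sqdist.
- by move=> x; rewrite le_min !sqr_ge0.
rewrite EFinD -!integral_sqdist//; congr (_ + _)%E;
  apply: eq_integral_itv_bounded => [||x].
- exact: measurable_min_sqdist.
- exact: measurable_sqdist.
- by rewrite in_itv => xI; rewrite min_l// min_a.
- exact: measurable_min_sqdist.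
- exact: measurable_sqdist.
- by rewrite in_itv => xI; rewrite min_r// min_b.
Qed.

Lemma integral_P {R : realType} (f : R -> R) :
  measurable_fun setT f -> (forall x, 0 <= f x) ->
  (\int[@P R]_x (f x)%:E =
   \int[lebesgue_measure]_(x in `[0%R, (2^-1)%R]%classic) (f x)%:E +
   ((f (2 / 3) + f (5 / 6) + f 1) / 6)%:E)%E.
Proof.
move=> /measurable_EFinP mf f0.
have f0E x : (0 <= (f x)%:E)%E by rewrite lee_fin.
rewrite /P /half_mixture ge0_integral_measure_add//.
rewrite !ge0_integral_mscale//.
rewrite integral_uniform//.
rewrite /P2 /discrete_D ge0_integral_measure_sum//.
rewrite !big_ord_recr big_ord0 /= add0e.
rewrite !ge0_integral_mscale// !integral_dirac//= !diracT !mul1e.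
(* The weight [1/2] cancels the density [2] of the uniform law. *)
rewrite muleA -EFinM subr0 invrK mulVf ?pnatr_eq0// mul1e.
congr (_ + _)%E; rewrite -!EFinM.
set y := f _; set z := f _; set w := f _.
rewrite -[LHS]/((2^-1 * (3^-1 * y + 3^-1 * z + 3^-1 * w))%:E).
by congr EFin; field.
Qed.

Lemma le_sqr_midpoint {R : realFieldType} (a b x : R) : a <= b ->
  x <= (a + b) / 2 -> (x - a) ^+ 2 <= (x - b) ^+ 2.
Proof. by move=> ab xm; nra. Qed.

Lemma ge_sqr_midpoint {R : realFieldType} (a b x : R) : a <= b ->
  (a + b) / 2 <= x -> (x - b) ^+ 2 <= (x - a) ^+ 2.
Proof. by move=> ab xm; nra. Qed.

(* [t] is where the Voronoi boundary [(a + b) / 2], clamped to [[0, 1 / 2]],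
   cuts the support of the uniform component. *)
Definition distortion2 {R : realFieldType} (t a b : R) : R :=
  let m x := Num.min ((x - a) ^+ 2) ((x - b) ^+ 2) in
  ((t - a) ^+ 3 - (0 - a) ^+ 3) / 3 + ((2^-1 - b) ^+ 3 - (t - b) ^+ 3) / 3 +
  (m (2 / 3) + m (5 / 6) + m 1) / 6.

Lemma distortion2_split {R : realFieldType} (t a b : R) : a <= b ->
  0 <= t < 2^-1 -> (a + b) / 2 <= t -> 17 / 864 < distortion2 t a b.
Proof.
move=> ab /andP[t0 t1] mt; rewrite /distortion2.
rewrite !min_r ?ge_sqr_midpoint//; try lra.
set G := (X in _ < X).
pose s := 2^-1 - t; have s0 : 0 < s by rewrite /s subr_gt0.
(* Complete the squares at the cell means: [t / 2] for [[0, t]], and [(s - s^2 + 5/6) / (2 s + 1)]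
   for the right cell, which has mass [s + 1/2]. The factor [2 * s + 1] clears the denominator. *)
have GE : (2 * s + 1) * (G - 17 / 864) =
    (2 * s + 1) * (t * (a - t / 2) ^+ 2) +
    ((2 * s + 1) * b - (s - s ^+ 2 + 5 / 6)) ^+ 2 / 2 +
    s * (7 / 144 + s / 3 + s ^+ 2 / 2).
  by rewrite /G /s; field.
have G0 : 0 < (2 * s + 1) * (G - 17 / 864).
  have h1 : 0 <= t * (a - t / 2) ^+ 2 by rewrite mulr_ge0// sqr_ge0.
  have h2 := sqr_ge0 ((2 * s + 1) * b - (s - s ^+ 2 + 5 / 6)).
  have h3 : 0 < s * (7 / 144 + s / 3 + s ^+ 2 / 2).
    by rewrite mulr_gt0//; have := sqr_ge0 s; lra.
  have h4 : 0 <= (2 * s + 1) * (t * (a - t / 2) ^+ 2).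
    by rewrite mulr_ge0//; lra.
  by rewrite GE; lra.
by move: G0; rewrite pmulr_rgt0 ?subr_gt0//; lra.
Qed.

(** The constant is [1/96 + 1/108], half the variance of each component. *)
Lemma distortion2_separated {R : realFieldType} (a b : R) : a <= b ->
  2^-1 <= (a + b) / 2 <= 2 / 3 ->
  distortion2 2^-1 a b =
  17 / 864 + (a - 1 / 4) ^+ 2 / 2 + (b - 5 / 6) ^+ 2 / 2.
Proof.
move=> ab /andP[m_ge m_le]; rewrite /distortion2.
by rewrite !min_r ?ge_sqr_midpoint//; [field|lra..].
Qed.

Lemma distortion2_crossing {R : realFieldType} (a b : R) : a <= b ->
  2 / 3 < (a + b) / 2 -> 17 / 864 < distortion2 2^-1 a b.
Proof.
move=> ab m_gt; rewrite /distortion2.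
rewrite (@min_l _ _ _ ((2 / 3 - b) ^+ 2)) ?le_sqr_midpoint ?(ltW m_gt)//.
set m1 := Num.min ((5 / 6 - a) ^+ 2) _.
set m2 := Num.min ((1 - a) ^+ 2) _.
have m1_ge0 : 0 <= m1 by rewrite le_min !sqr_ge0.
have m2_ge0 : 0 <= m2 by rewrite le_min !sqr_ge0.
(* [17/48] is the mean of mass [1/2] spread over [[0, 1/2]] and mass [1/6] at [2/3]; [25/1152] is
   the cost of merging the two. *)
have := sqr_ge0 (a - 17 / 48).
set G := (X in _ < X).
have -> : G = 1 / 96 + 25 / 1152 + 2 / 3 * (a - 17 / 48) ^+ 2 + (m1 + m2) / 6.
  by rewrite /G; field.
lra.
Qed.

(** The two guarded inequalities encode the clamping: at [t = 0] the midpoint is only bounded above,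
    at [t = 1/2] only below. *)
Lemma distortion_P {R : realType} (alpha : {fset R}) (t a b : R) :
  (forall x, min_sqdist alpha x =
             (Num.min ((x - a) ^+ 2) ((x - b) ^+ 2))%:E) ->
  a <= b -> 0 <= t <= 2^-1 -> (0 < t -> t <= (a + b) / 2) ->
  (t < 2^-1 -> (a + b) / 2 <= t) ->
  distortion P alpha = (distortion2 t a b)%:E.
Proof.
move=> minE ab tI m_ge m_le; have /andP[t0 t1] := tI.
rewrite /distortion (funext minE).
rewrite (integral_P (fun x => Num.min ((x - a) ^+ 2) ((x - b) ^+ 2))).
- rewrite (integral_min_sqdist 0 t) ?EFinD// => x /andP[x_gt x_lt].
  + by apply: le_sqr_midpoint => //; apply: le_trans (ltW x_lt) (m_ge _);
      exact: lt_trans x_gt x_lt.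
  + by apply: ge_sqr_midpoint => //; apply: le_trans (m_le _) (ltW x_gt);
      exact: lt_trans x_gt x_lt.
- exact: measurable_min_sqdist.
- by move=> x; rewrite le_min !sqr_ge0.
Qed.

(** The bound is strict unless the midpoint lies in [[1/2, 2/3]], where the excess is a sum of
    squares with a single zero. *)
Lemma distortion_P_ge {R : realType} (alpha : {fset R}) :
  (1 <= #|` alpha| <= 2)%N ->
  ((17 / 864)%:E <= distortion P alpha)%E /\
  (distortion P alpha = (17 / 864)%:E -> alpha = [fset 1 / 4; 5 / 6]%fset).
Proof.
move=> /min_sqdist_card2[a [b [ab -> minE]]].
have [m_lt|m_ge] := ltP ((a + b) / 2) 2^-1.
  pose t := Num.max 0 ((a + b) / 2).
  have t_ge0 : 0 <= t by rewrite le_max lexx.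
  have t_lt : t < 2^-1 by rewrite gt_max m_lt invr_gt0 ltr0n.
  have m_le : (a + b) / 2 <= t by rewrite le_max lexx orbT.
  rewrite (distortion_P _ t _ _ minE ab) ?t_ge0 ?(ltW t_lt)//; last first.
    by rewrite /t lt_max ge_max ltxx lexx andbT => /ltW.
  have lt_d : 17 / 864 < distortion2 t a b.
    by apply: distortion2_split => //; rewrite t_ge0.
  by split=> [|[dE]]; [rewrite lee_fin ltW | move: lt_d; rewrite dE ltxx].
rewrite (distortion_P _ 2^-1 _ _ minE ab) ?lexx ?invr_ge0 ?ler0n ?ltxx//.
rewrite lee_fin; have [m_le|m_gt] := leP ((a + b) / 2) (2 / 3); last first.
  have lt_d := distortion2_crossing _ _ ab m_gt.
  by split=> [|[dE]]; [rewrite ltW | move: lt_d; rewrite dE ltxx].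
rewrite distortion2_separated ?m_ge//.
have a_ge0 := sqr_ge0 (a - 1 / 4); have b_ge0 := sqr_ge0 (b - 5 / 6).
split=> [|[dE]]; first by lra.
have /eqP : (a - 1 / 4) ^+ 2 = 0 by lra.
have /eqP : (b - 5 / 6) ^+ 2 = 0 by lra.
by rewrite !sqrf_eq0 !subr_eq0 => /eqP -> /eqP ->.
Qed.

Theorem lemma2p6p1 (R : realType) :
  (forall alpha : {fset R}, optimal_set 2 P alpha ->
     alpha = [fset (1 / 4 : R); 5 / 6]%fset) /\
  quant_error 2 (@P R) = (17 / 864)%:E.
Proof.
have errorE : quant_error 2 (@P R) = (17 / 864)%:E.
  apply/eqP; rewrite eq_le; apply/andP; split; last first.
    by apply: le_ereal_inf_tmp => _ [alpha /= /distortion_P_ge[ge_d _] <-].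
  pose alpha : {fset R} := [fset 1 / 4; 5 / 6]%fset.
  have card_alpha : (1 <= #|` alpha| <= 2)%N by rewrite cardfs2; case: eqP.
  apply: ereal_inf_lbound; exists alpha => //=.
  have [a [b [ab alphaE minE]]] := min_sqdist_card2 _ card_alpha.
  (* The pair obtained is not known to be the chosen one; membership of both points together with
     [a <= b] identifies it. *)
  have [aE bE] : a = 1 / 4 /\ b = 5 / 6.
    have : 1 / 4 \in alpha by rewrite !inE eqxx.
    have : 5 / 6 \in alpha by rewrite !inE eqxx orbT.
    rewrite alphaE !inE => /orP[] /eqP a1 /orP[] /eqP b1; split; lra.
  have tI : 2^-1 <= (a + b) / 2 <= 2 / 3 by rewrite aE bE; lra.
  rewrite (distortion_P _ 2^-1 _ _ minE ab) ?lexx ?invr_ge0 ?ler0n ?ltxx//.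
    by rewrite distortion2_separated// aE bE !subrr expr0n mul0r !addr0.
  by case/andP: tI.
split=> // alpha [/distortion_P_ge[_ dP] dE].
by apply: dP; rewrite dE.
Qed.
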